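(* Let $X \subseteq \mathcal A^{\mathbb Z}$ be a thin subshift over a finite alphabet $\mathcal A$. Then for any two invariant measures $\mu_1, \mu_2$ on $X$ one has $\mu_1 = \mu_2$ if and only if $\mu_1([a]) = \mu_2([a])$ for every letter $a \in \mathcal A$.
   Context: For a finite alphabet $\mathcal A$, $\mathcal A^{\mathbb Z}$ carries the product topology and the shift map $T$ (shifting coordinate indices by $1$), a homeomorphism. A subshift is a closed set $X\subseteq \mathcal A^{\mathbb Z}$ with $T(X)=X$. An invariant measure on $X$ is a finite $T$-invariant Borel measure on $\mathcal A^{\mathbb Z}$ whose support is contained in $X$; $\mathcal M(X)$ denotes the cone of such measures. For a word $w = y_1\cdots y_n$ in the free monoid $\mathcal A^*$, the cylinder $[w]$ is the set of all $x = (x_i)_{i\in\mathbb Z}\in \mathcal A^{\mathbb Z}$ with $x_i = y_i$ for $i=1,\dots,n$. The letter cone $\mathcal C(X)\subseteq \mathbb R^{\mathcal A}$ is the image of $\mathcal M(X)$ under $\mu \mapsto (\mu([a]))_{a\in\mathcal A}$, and $c(X)$ denotes its dimension. A directive sequence is a sequence $(\sigma_n)_{n\ge 0}$ of monoid morphisms $\sigma_n:\mathcal A_{n+1}^*\to\mathcal A_n^*$ between free monoids over finite alphabets $\mathcal A_n$, with $\mathcal A_0=\mathcal A$. The subshift generated by it consists of all $x\in\mathcal A^{\mathbb Z}$ such that every finite factor $x_j\cdots x_k$ of $x$ is a factor of $\sigma_0\circ\cdots\circ\sigma_{n-1}(a)$ for some $n$ and some $a\in\mathcal A_n$; if $X$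 is this subshift, the sequence is called an ($S$-adic) development of $X$. It is everywhere growing if $\min\{|\sigma_0\circ\cdots\circ\sigma_{n-1}(a)| : a\in\mathcal A_n\}\to\infty$ as $n\to\infty$. For $n\ge0$, the level-$n$ subshift $X_n\subseteq\mathcal A_n^{\mathbb Z}$ is the subshift generated by the directive sequence $(\sigma_m)_{m\ge n}$ (so $X_0=X$), and $c_n := c(X_n)$. The directive sequence is thin if $c_n = c(X)$ for all $n\ge 0$. A subshift $X$ is thin if it has a development which is everywhere growing, has bounded cardinalities $\mathrm{card}(\mathcal A_n)$, and is thin. *)

(* Defs.v *)
From HB Require Import structures.
From mathcomp Require Import all_boot all_order all_algebra.
From mathcomp Require Import all_classical all_reals all_analysis.
Set Implicit Arguments. Unset Strict Implicit. Unset Printing Implicit Defensive.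
Import Order.TTheory GRing.Theory Num.Theory.
Local Open Scope classical_set_scope.
Local Open Scope ring_scope.

#[short(type="alphabetType")]
HB.structure Definition Alphabet := {T of Finite T & isPointed T}.

Definition seqsp (A : alphabetType) : topologicalType := {ptws int -> discrete_topology A}.

Definition borel_seqsp (A : alphabetType) := g_sigma_algebraType (@open (seqsp A)).

Definition shift (A : alphabetType) (x : seqsp A) : seqsp A := fun i => x (i + 1)%R.

Definition subshift (A : alphabetType) (X : set (seqsp A)) : Prop :=
  closed X /\ (@shift A) @` X = X.

Definition cyl (A : alphabetType) (a : A) : set (borel_seqsp A) :=
  [set x | x 1%R = a].

Definition msupport (R : realType) (A : alphabetType)
  (mu : {measure set (borel_seqsp A) -> \bar R}) : set (seqsp A) :=
  [set x | forall U : set (seqsp A), open U -> U x -> (0 < mu U)%E].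

Definition invariant_measure_on (R : realType) (A : alphabetType) (X : set (seqsp A))
  (mu : {measure set (borel_seqsp A) -> \bar R}) : Prop :=
  [/\ (mu setT < +oo)%E,
      (forall S : set (borel_seqsp A), measurable S ->
          mu ((@shift A) @^-1` S) = mu S)
    & msupport mu `<=` X].

Definition letter_cone (R : realType) (A : alphabetType) (X : set (seqsp A))
  : set 'rV[R]_#|A| :=
  [set v | exists mu : {measure set (borel_seqsp A) -> \bar R},
      invariant_measure_on X mu /\
      v = \row_(i < #|A|) fine (mu (cyl (enum_val i)))].

(** [cone_dim C d]: the dimension of (the linear span of) C is d, i.e. d is the
    maximal rank of a finite family of vectors of C. *)
Definition cone_dim (R : realType) (k : nat) (C : set 'rV[R]_k) (d : nat) : Prop :=
  (exists m (M : 'M[R]_(m, k)), (forall i, C (row i M)) /\ \rank M = d) /\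
  (forall m (M : 'M[R]_(m, k)), (forall i, C (row i M)) -> (\rank M <= d)%N).

(** Directive sequences over A: level alphabets A_0 = A, A_(n+1) = Alph' n,
    and morphisms sigma_n : A_(n+1)^* -> A_n^*, given by the images of letters. *)
Definition lvl (A : alphabetType) (Alph' : nat -> alphabetType) (n : nat) : alphabetType :=
  match n with 0 => A | m.+1 => Alph' m end.

Local Unset Implicit Arguments.
Section Directive.
Variables (Alph : nat -> alphabetType) (sig : forall n, Alph n.+1 -> seq (Alph n)).

Definition morph n (w : seq (Alph n.+1)) : seq (Alph n) := flatten (map (@sig n) w).

(** [comp n k w] = sigma_n o ... o sigma_(n+k-1) (w) for w a word over A_(k+n). *)
Fixpoint comp (n k : nat) : seq (Alph (k + n)) -> seq (Alph n) :=
  match k return seq (Alph (k + n)) -> seq (Alph n) with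
  | 0 => fun w => w
  | k'.+1 => fun w => comp n k' (morph (k' + n) w)
  end.

Definition window (B : alphabetType) (x : seqsp B) (j : int) (l : nat) : seq B :=
  [seq x (j + i%:Z)%R | i <- iota 0 l].

Definition level_subshift (n : nat) : set (seqsp (Alph n)) :=
  [set x : seqsp (Alph n) | forall (j : int) (l : nat), exists k (a : Alph (k + n)),
      infix (window _ x j l) (comp n k [:: a])].

Definition everywhere_growing : Prop :=
  forall N : nat, exists n0, forall n, (n0 <= n)%N ->
    forall a : Alph (n + 0), (N <= size (comp 0 n [:: a]))%N.

Definition bounded_alphabets : Prop := exists B, forall n, (#|Alph n| <= B)%N.

Definition thin_directive (R : realType) : Prop :=
  exists d, cone_dim (@letter_cone R _ (level_subshift 0)) d /\
    forall n, cone_dim (@letter_cone R _ (level_subshift n)) d.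

End Directive.
Local Set Implicit Arguments.

Definition thin_subshift (R : realType) (A : alphabetType) (X : set (seqsp A)) : Prop :=
  exists (Alph' : nat -> alphabetType) (sig : forall n, lvl A Alph' n.+1 -> seq (lvl A Alph' n)),
    level_subshift _ sig 0 = X /\
    everywhere_growing _ sig /\ bounded_alphabets (lvl A Alph') /\ thin_directive _ sig R.

(* Main.v *)
Require Import Defs.
From HB Require Import structures.
From mathcomp Require Import all_boot all_order all_algebra.
From mathcomp Require Import all_classical all_reals all_analysis.
From mathcomp Require Import zify lra.
Import Order.TTheory GRing.Theory Num.Theory.
Import numFieldNormedType.Exports.
Local Open Scope classical_set_scope.
Local Open Scope ring_scope.

(** Let tau_n = sigma_0 o ... o sigma_(n-1), with n so large that tau_n erases no
    letter. Every invariant measure mu on X lifts to an invariant measure nu on X_n: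
    cut the words u of length L charged by mu, choose for each a word w of the level-n
    language with u a factor of tau_n(w) and w as short as possible up to a constant,
    average the empirical distributions of these w, and let L tend to infinity along an
    ultrafilter. Counting occurrences of a word v inside the blocks tau_n(b), or across
    at most |v| - 1 positions per block boundary, gives
      sum_b nu[b] |tau_n(b)|_v <= mu[v] <= sum_b nu[b] (|tau_n(b)|_v + |v| - 1),
    which for letters is an equality: the incidence matrix of tau_n maps the letter
    vector of nu to that of mu. Since both letter cones have the same dimension, this
    matrix is injective on the level-n cone, so two measures mu_1, mu_2 with the same
    letter frequencies have lifts with the same letter vector, whence
      |mu_1[v] - mu_2[v]| <= |v| sum_b nu[b] <= |v| mu_1(X) / min_b |tau_n(b)|,
    and the right-hand side tends to 0 because the development is everywhere growing. *)

(** * The space of bi-infinite sequences *)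

Lemma coord_continuous (A : alphabetType) (i : int) :
  continuous (fun x : seqsp A => x i : discrete_topology A).
Proof. exact: (@proj_continuous int (fun=> discrete_topology A) i). Qed.

Lemma coord_clopen (A : alphabetType) (i : int) (P : set A) :
  clopen [set x : seqsp A | P (x i)].
Proof.
split.
  have /continuousP cA := @coord_continuous A i.
  by apply: cA; exact: (@discrete_open (discrete_topology A)).
apply: (@closed_comp _ _ (fun x : seqsp A => x i : discrete_topology A) P).
  by move=> x _; exact: coord_continuous.
exact: (@discrete_closed (discrete_topology A)).
Qed.

Lemma seqsp_compact (A : alphabetType) : compact [set: seqsp A].
Proof.
have := @tychonoff int (fun _ => discrete_topology A) (fun _ => setT).
have -> : [set f : int -> discrete_topology A | forall i, [set: discrete_topology A] (f i)] = setT
  by apply/seteqP; split.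
apply=> _; apply: finite_compact; exact: (@finite_finset A setT).
Qed.

Definition ball_cyl (A : alphabetType) (N : nat) (x : seqsp A) : set (seqsp A) :=
   [set y : seqsp A | forall i : int, (`|i| <= N)%N -> y i = x i].

(** The filter generated by the sets [ball_cyl A N x] converges to [x] in every coordinate, hence in
    the product topology, and [U] is a neighbourhood of [x]. *)
Lemma open_ball_cyl (A : alphabetType) (U : set (seqsp A)) x : open U -> U x ->
  exists N, ball_cyl A N x `<=` U.
Proof.
move=> oU Ux.
pose F := filter_from [set: nat] (fun N => ball_cyl A N x).
have FF : Filter F.
  apply: filter_from_filter; first by exists 0%N.
  by move=> i j _ _; exists (maxn i j) => // y By; split => k Hk; apply: By; lia.
have Fx : F --> (x : seqsp A).
  apply/cvg_sup => i; apply/cvg_image.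
    by rewrite eqEsubset; split => // y _; exists (fun=> y).
  move=> V /nbhs_singleton Vx; exists ((fun y => y i) @^-1` V).
    by exists `|i|%N => // y By; rewrite /preimage /= By.
  by apply/seteqP; split => [_ [y Vy <-]//|v Vv]; exists (fun=> v).
have [N _ NU] : F U by apply: Fx; exact: open_nbhs_nbhs.
by exists N.
Qed.

(** * From finitely additive functions on clopen sets to Borel measures *)

(* An alias of [seqsp A] carrying the algebra of clopen sets instead of the Borel sets. *)
Definition clopen_space (A : alphabetType) : Type := int -> A.

HB.instance Definition _ (A : alphabetType) :=
  Pointed.copy (clopen_space A) (int -> A).

Definition clopen_sets (A : alphabetType) : set (set (clopen_space A)) :=
  [set S | clopen (S : set (seqsp A))].

Lemma clopen_sets0 (A : alphabetType) : clopen_sets A set0.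
Proof. exact: clopen0. Qed.

Lemma clopen_setsU (A : alphabetType) : setU_closed (clopen_sets A).
Proof. by move=> S T; exact: clopenU. Qed.

Lemma clopen_setsC (A : alphabetType) : setC_closed (clopen_sets A).
Proof. by move=> S; exact: clopenC. Qed.

Definition clopen_display : measure_display. Proof. exact. Qed.

HB.instance Definition _ (A : alphabetType) :=
  isAlgebraOfSets.Build clopen_display (clopen_space A)
    (clopen_sets0 A) (@clopen_setsU A) (@clopen_setsC A).

Definition finitary (A : alphabetType) (N : nat) (S : set (seqsp A)) :=
  forall x y, S x -> ball_cyl A N x y -> S y.

Lemma ball_cyl_sym (A : alphabetType) N (x y : seqsp A) :
  ball_cyl A N x y -> ball_cyl A N y x.
Proof. by move=> xy i iN; rewrite xy. Qed.

Lemma ball_cyl_trans (A : alphabetType) N (x y z : seqsp A) :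
  ball_cyl A N x y -> ball_cyl A N y z -> ball_cyl A N x z.
Proof. by move=> xy yz i iN; rewrite yz ?xy. Qed.

Lemma finitary_le (A : alphabetType) (M N : nat) (S : set (seqsp A)) :
  (M <= N)%N -> finitary A M S -> finitary A N S.
Proof.
by move=> MN fS x y Sx xy; apply: fS Sx _ => i iM; apply: xy; exact: leq_trans MN.
Qed.

Lemma ball_cyl_open (A : alphabetType) N (x : seqsp A) : open (ball_cyl A N x).
Proof.
elim: N => [|N IH].
  have -> : ball_cyl A 0 x = [set y : seqsp A | [set x 0] (y 0)].
    apply/seteqP; split => [y /(_ 0 (leqnn _))//|y /= y0 i].
    by rewrite leqn0 absz_eq0 => /eqP ->.
  by have [] := coord_clopen A 0 [set x 0].
have -> : ball_cyl A N.+1 x = ball_cyl A N x `&`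
   ([set y : seqsp A | [set x N.+1%:Z] (y N.+1%:Z)] `&`
    [set y : seqsp A | [set x (- N.+1%:Z)] (y (- N.+1%:Z))]).
  apply/seteqP; split => [y By|y [By [/= y1 y2]] i iN].
    split; last by split; apply: By; lia.
    by move=> i iN; apply: By; lia.
  have [iN'|iN'] := leqP `|i| N; first exact: By.
  by have [->|->] : i = N.+1%:Z \/ i = - N.+1%:Z by lia.
apply: openI => //; apply: openI; first by have [] := coord_clopen A N.+1%:Z [set x N.+1%:Z].
by have [] := coord_clopen A (- N.+1%:Z) [set x (- N.+1%:Z)].
Qed.

Lemma finitary_open (A : alphabetType) N (S : set (seqsp A)) :
  finitary A N S -> open S.
Proof.
move=> fS; have -> : S = \bigcup_(x in S) ball_cyl A N x.
  apply/seteqP; split => [x Sx|x [y Sy]]; first by exists x.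
  exact: fS.
by apply: bigcup_open => x _; exact: ball_cyl_open.
Qed.

Lemma finitary_clopen (A : alphabetType) N (S : set (seqsp A)) :
  finitary A N S -> clopen S.
Proof.
move=> fS; split; first exact: finitary_open fS.
rewrite -openC; apply: (@finitary_open _ N) => x y Sx xy Sy; apply: Sx.
exact: fS Sy (ball_cyl_sym _ _ _ _ xy).
Qed.

Lemma finitary_borel (A : alphabetType) N (S : set (seqsp A)) :
  finitary A N S -> measurable (S : set (borel_seqsp A)).
Proof. by move=> /finitary_open oS; exact: sub_sigma_algebra. Qed.

Definition finitary_sets (A : alphabetType) : set (set (seqsp A)) :=
  [set S | exists N, finitary A N S].

(** An open [U] is the union over [N] of the sets of points whose [N]-ball lies in [U]. This union
    is countable, and its [N]-th member is [N]-finitary. *)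
Lemma borel_finitary (A : alphabetType) :
  (measurable : set (set (borel_seqsp A))) = <<s finitary_sets A >>.
Proof.
apply/seteqP; split; last first.
  apply: (smallest_sub (@sigma_algebra_measurable _ (borel_seqsp A))).
  by move=> S [N /finitary_borel].
apply: smallest_sub; first exact: smallest_sigma_algebra.
move=> U oU; pose W N := [set x | ball_cyl A N x `<=` U].
have -> : U = \bigcup_N W N.
  apply/seteqP; split => [x Ux|x [N _]]; last by apply.
  by have [N NU] := open_ball_cyl A U x oU Ux; exists N.
apply: sigma_algebra_bigcup => N; apply: sub_sigma_algebra; exists N => x y Wx xy z yz.
by apply: Wx; exact: ball_cyl_trans yz.
Qed.

Lemma borel_clopen (A : alphabetType) :
  (measurable : set (set (borel_seqsp A))) = <<s (clopen_sets A : set (set (seqsp A))) >>.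
Proof.
apply/seteqP; split; last first.
  apply: (smallest_sub (@sigma_algebra_measurable _ (borel_seqsp A))).
  by move=> S [oS _]; exact: sub_sigma_algebra.
rewrite borel_finitary; apply: smallest_sub; first exact: smallest_sigma_algebra.
by move=> S [N /finitary_clopen cS]; exact: sub_sigma_algebra.
Qed.

Lemma clopen_bigU (T : topologicalType) (F : nat -> set T) N :
  (forall i, clopen (F i)) -> clopen (\big[setU/set0]_(i < N) F i).
Proof.
move=> cF; elim: N => [|N IH]; first by rewrite big_ord0; exact: clopen0.
by rewrite big_ord_recr; exact: clopenU.
Qed.

Section clopen_content.
Context (R : realType) (A : alphabetType) (m : set (seqsp A) -> R).
Hypothesis m_ge0 : forall S, 0 <= m S.
Hypothesis mU : forall S T, S `&` T = set0 -> m (S `|` T) = m S + m T.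

(** Only finite additivity of [m] is given, as for a limit along an ultrafilter. Restricting to
    clopen sets is what makes countable additivity available. *)
Definition clopen_content (S : set (clopen_space A)) : \bar R := (m S)%:E.

Lemma content_set0 : m set0 = 0.
Proof. by have := mU set0 set0 (setI0 _); rewrite setU0; lra. Qed.

Lemma content_le S T : S `<=` T -> m S <= m T.
Proof.
move=> ST; rewrite -(setUIDK T S) (setIidr ST) mU ?lerDl//.
by rewrite setDE setIC -setIA setICl setI0.
Qed.

Lemma content_bigU (I : Type) (r : seq I) (F : I -> set (seqsp A)) :
  m (\big[setU/set0]_(i <- r) F i) <= \sum_(i <- r) m (F i).
Proof.
elim/big_rec2: _ => [|i x S _ IH]; first by rewrite content_set0.
rewrite -(setDUK (B := F i `|` S) (A := F i)); last by move=> y Fy; left.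
rewrite mU; last by rewrite setDE setIC -setIA setICl setI0.
by rewrite lerD2l; apply: le_trans IH; apply: content_le => y [[]].
Qed.

Lemma clopen_content_ge0 S : (0 <= clopen_content S)%E.
Proof. by rewrite lee_fin. Qed.

Lemma clopen_content_additive : measure_function.semi_additive clopen_content.
Proof.
move=> F n _ tF _; rewrite /clopen_content sumEFin; congr EFin.
elim: n => [|n IH]; first by rewrite !big_ord0 content_set0.
rewrite !big_ord_recr /= mU ?IH//.
apply/seteqP; split => // x [] ; rewrite -bigcup_mkord => -[k /= kn Fk] Fn.
have kE : k = n by apply: tF => //; exists x.
by move: kn; rewrite kE ltnn.
Qed.

HB.instance Definition _ := isContent.Build _ _ _ clopen_content
  clopen_content_ge0 clopen_content_additive.

Lemma clopen_content_subadditive :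
  measurable_subset_sigma_subadditive clopen_content.
Proof.
move=> S F oF oS SF.
pose G N := \big[setU/set0]_(i < N) F i.
(* By compactness finitely many of the [F i] already cover [S]. *)
have [N SN] : exists N, S `<=` G N.
  (* Otherwise the sets [S \ G N] generate a proper filter. They are closed, so a cluster point [p]
     lies in all of them, although some [F i] contains it. *)
  apply: contrapT => noN.
  pose B := filter_from [set: nat] (fun N => S `\` G N).
  have GS i j : (i <= j)%N -> G i `<=` G j.
    move=> ij x; rewrite /G -!bigcup_mkord => -[k /= ki Fk]; exists k => //=.
    exact: leq_trans ij.
  have FB : ProperFilter B.
    apply: filter_from_proper.
      apply: filter_from_filter; first by exists 0%N.
      move=> i j _ _; exists (maxn i j) => // y [Sy Gy].
      by split; split => // Gy'; apply: Gy; apply: GS Gy'; lia.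
    move=> N _; apply/set0P/eqP => SG0; apply: noN; exists N.
    by rewrite -setD_eq0.
  have BS N : B (S `\` G N) by exists N.
  have [p [_ pcl]] := @seqsp_compact A B FB filterT.
  have pS N : (S `\` G N) p.
    have : clopen (S `\` G N : set (seqsp A)).
      have cG : clopen (G N : set (seqsp A)) by exact: (@clopen_bigU (seqsp A)).
      by rewrite setDE; apply: (clopenI (oS : clopen (S : set (seqsp A)))); exact: clopenC.
    move=> [_ /closure_id ->] U Up; exact: pcl.
  have [i _ Fi] := SF _ (pS 0%N).1.
  by apply: (pS i.+1).2; rewrite /G big_ord_recr; right.
have : (clopen_content S <= \sum_(0 <= i < N) clopen_content (F i))%E.
  rewrite /clopen_content sumEFin lee_fin big_mkord.
  by apply: le_trans (content_bigU _ _ _); apply: content_le.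
move/le_trans; apply; exact: nneseries_lim_ge.
Qed.

HB.instance Definition _ := Content_SigmaSubAdditive_isMeasure.Build _ _ _
  clopen_content clopen_content_subadditive.

Lemma clopen_content_extend :
  exists nu : {measure set (borel_seqsp A) -> \bar R},
    forall S : set (seqsp A), clopen S -> nu S = (m S)%:E.
Proof.
(* The Carathéodory extension lives on the sigma-algebra generated by the clopen sets. The
   pushforward along the identity carries it to the Borel sets, by [borel_clopen]. *)
pose I := g_sigma_algebraType (@measurable _ (clopen_space A)).
have mid : measurable_fun setT (idfun : I -> borel_seqsp A).
  by move=> _ Y mY; rewrite setTI preimage_id; move: mY; rewrite borel_clopen.
pose m0 : {measure set (clopen_space A) -> \bar R} := clopen_content.
pose mu : {measure set I -> \bar R} := measure_extension m0.
pose nu := @measure_function_pushforward__canonical__measure_function_Measure _ _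
   I (borel_seqsp A) R mu idfun mid.
exists nu.
move=> S cS.
have E := @measurable_mu_extE _ R (clopen_space A) m0 S cS.
by transitivity (clopen_content S) => //; rewrite -E.
Qed.

End clopen_content.

(** * Cylinders and equality of measures *)

Section cylinders.
Context (R : realType) (A : alphabetType).

Lemma borel_measure_ext (mu1 mu2 : {measure set (borel_seqsp A) -> \bar R}) :
  (mu1 setT < +oo)%E ->
  (forall N (S : set (seqsp A)), finitary A N S -> mu1 S = mu2 S) ->
  forall S : set (borel_seqsp A), measurable S -> mu1 S = mu2 S.
Proof.
move=> mu1T H S mS.
apply: (@measure_unique _ R (borel_seqsp A) (finitary_sets A) (fun=> setT)) => //.
- exact: borel_finitary.
- move=> X Y [M fX] [N fY]; exists (maxn M N) => x y [Xx Yx] xy; split.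
    by apply: (finitary_le _ _ _ _ (leq_maxl _ _) fX) xy.
  by apply: (finitary_le _ _ _ _ (leq_maxr _ _) fY) xy.
- by move=> _; exists 0%N.
- by rewrite bigcup_const.
- by move=> X [N]; exact: H.
Qed.

Definition cylinder (j : int) (u : seq A) : set (borel_seqsp A) :=
  [set x | window A x j (size u) = u].

Lemma cylinder_finitary j u : finitary A (`|j| + size u) (cylinder j u).
Proof.
move=> x y; rewrite /cylinder /= => ux xy; rewrite -[RHS]ux.
apply/eq_in_map => i.
by rewrite mem_iota => /andP[_ iu]; apply: xy; lia.
Qed.

Lemma cylinder_borel j u : measurable (cylinder j u).
Proof. exact: finitary_borel (cylinder_finitary j u). Qed.

Lemma measure_big_setU (I : choiceType) (r : seq I) (F : I -> set (borel_seqsp A))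
    (mu : {measure set (borel_seqsp A) -> \bar R}) :
  uniq r -> (forall i, measurable (F i)) ->
  (forall i j, i != j -> F i `&` F j = set0) ->
  mu (\big[setU/set0]_(i <- r) F i) = (\sum_(i <- r) mu (F i))%E.
Proof.
move=> + mF F0; elim: r => [|i r IH] /=; first by rewrite !big_nil measure0.
move=> /andP[ir ur]; rewrite !big_cons measureU //.
- by congr (_ + _)%E; exact: IH.
- by apply: big_ind; [exact: measurable0|move=> X Y; exact: measurableU|move=> k _; exact: mF].
apply/seteqP; split => // x [Fi]; rewrite -bigcup_seq => -[k /= kr Fk].
have [ik|ik] := eqVneq i k; first by move: ir; rewrite ik kr.
have : (F i `&` F k) x by [].
by rewrite (F0 _ _ ik).
Qed.

Lemma cylinder_disjoint j u v : size u = size v -> u != v ->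
  cylinder j u `&` cylinder j v = set0.
Proof.
move=> uv /eqP neq; apply/seteqP; split => // x []; rewrite /cylinder /= uv => ux vx.
by apply: neq; rewrite -ux vx.
Qed.

Lemma cylinder_window (x : seqsp A) j l : cylinder j (window A x j l) x.
Proof. by rewrite /cylinder /= size_map size_iota. Qed.

Lemma measure_cylinders (mu : {measure set (borel_seqsp A) -> \bar R}) j l
  (S : set (borel_seqsp A)) : measurable S ->
  mu S = (\sum_(u : l.-tuple A) mu (S `&` cylinder j u))%E.
Proof.
move=> mS; rewrite -measure_big_setU.
- congr (mu _); rewrite -bigcup_seq; apply/seteqP; split => [x Sx|x [u _ []//]].
  have sw : size (window A x j l) == l by rewrite size_map size_iota.
  exists (Tuple sw); first by rewrite /= mem_index_enum.
  by split => //; exact: cylinder_window.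
- exact: index_enum_uniq.
- by move=> u; apply: measurableI => //; exact: cylinder_borel.
- move=> u v uv; rewrite setIACA cylinder_disjoint ?setI0// ?size_tuple//.
Qed.

(** The words of length [2N+1] read from [-N] cut the space into cylinders, each of which an
    [N]-finitary set either contains or misses. *)
Lemma finitary_measure_eq (mu1 mu2 : {measure set (borel_seqsp A) -> \bar R}) :
  (forall j u, mu1 (cylinder j u) = mu2 (cylinder j u)) ->
  forall N (S : set (seqsp A)), finitary A N S -> mu1 S = mu2 S.
Proof.
move=> H N S fS.
have mS := finitary_borel _ _ _ fS.
rewrite (measure_cylinders mu1 (- N%:Z) (N.*2.+1) _ mS).
rewrite (measure_cylinders mu2 (- N%:Z) (N.*2.+1) _ mS).
apply: eq_bigr => u _.
have [[x [Sx ux]]|no] := pselect (exists x, (S `&` cylinder (- N%:Z) u) x); last first.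
  have -> : S `&` cylinder (- N%:Z) u = set0.
    by apply/seteqP; split => // x Sx; apply: no; exists x.
  by rewrite !measure0.
rewrite setIidr ?H// => y uy; apply: fS Sx _ => i iN.
move: uy ux; rewrite /cylinder /= => {2}<-; rewrite /window size_tuple => /eq_in_map E.
have := E (`|(i + N%:Z)%R|%N); rewrite mem_iota.
have -> : (- N%:Z + `|(i + N%:Z)%R|%N) = i by lia.
by move=> ->//; lia.
Qed.

End cylinders.

Arguments cylinder {A}.

Lemma cylE (A : alphabetType) (a : A) : cyl a = cylinder 1 [:: a].
Proof.
apply/funext => x; rewrite /cyl /cylinder /= /window /= addr0.
by apply/propext; split => [->|[]].
Qed.

(** * Occurrences of words and composition of morphisms *)

Section occurrences.
Context (T : eqType).
Implicit Types (v s t u : seq T).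

(** Overlapping occurrences all count. The empty suffix is never inspected, so the empty word occurs
    [size s] times. *)
Fixpoint occ v s : nat := if s is x :: s' then (prefix v s + occ v s')%N else 0%N.

Lemma occE v s : occ v s = (\sum_(i < size s) prefix v (drop i s))%N.
Proof.
elim: s => [|x s IH]; first by rewrite big_ord0.
by rewrite [LHS]/= IH big_ord_recl drop0; congr addn; apply: eq_bigr.
Qed.

Lemma occ_cons v x s : occ v (x :: s) = (prefix v (x :: s) + occ v s)%N.
Proof. by []. Qed.

Lemma occ_size v s : (occ v s <= size s)%N.
Proof. by elim: s => // x s IH; rewrite occ_cons [size _]/=; case: (prefix v _); lia. Qed.

Lemma prefix_cat v s t : (size v <= size s)%N -> prefix v (s ++ t) = prefix v s.
Proof. by move=> vs; rewrite !prefixE takel_cat. Qed.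

Lemma prefix_catW v s t : prefix v s -> prefix v (s ++ t).
Proof. by case/prefixP => r ->; rewrite -catA prefix_prefix. Qed.

Lemma occ_cat_ge v s t : (occ v s + occ v t <= occ v (s ++ t))%N.
Proof.
elim: s => [//|x s IH]; rewrite cat_cons.
have := prefix_catW v (x :: s) t; rewrite cat_cons !occ_cons.
by case: (prefix v (x :: s)) => [->//|_]; lia.
Qed.

(** An occurrence straddling the boundary starts at one of the last [(size v).-1] letters of [s]. *)
Lemma occ_cat_le v s t :
  (occ v (s ++ t) <= occ v s + occ v t + minn (size s) (size v).-1)%N.
Proof.
elim: s => [|x s IH]; first by rewrite min0n addn0.
have := prefix_cat v (x :: s) t; rewrite cat_cons !occ_cons.
have -> : size (x :: s) = (size s).+1 by [].
have [vs /(_ isT) ->|vs _] := leqP (size v) (size s).+1; first by lia.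
by case: (prefix v (x :: s ++ t)); lia.
Qed.

(** The occurrences inside [p] and [s] are at most their lengths, and each of the two boundaries
    costs less than [size v] when [v] is nonempty, nothing otherwise. *)
Lemma occ_infix v p u s :
  (occ v u <= occ v (p ++ u ++ s) <= occ v u + size p + size s + (size v).*2)%N.
Proof.
have := occ_cat_ge v p (u ++ s); have := occ_cat_ge v u s.
have := occ_cat_le v p (u ++ s); have := occ_cat_le v u s.
have := occ_size v p; have := occ_size v s; lia.
Qed.

Lemma occ_seq1 x s : occ [:: x] s = count_mem x s.
Proof. by elim: s => //= y s ->; rewrite eq_sym prefix0s andbT. Qed.

End occurrences.

Section factors.
Context (S T : eqType) (f : S -> seq T).
Local Notation tau w := (flatten (map f w)).

Lemma occ_flatten v w :
  (\sum_(x <- w) occ T v (f x) <= occ T v (tau w)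
     <= \sum_(x <- w) (occ T v (f x) + (size v).-1))%N.
Proof.
elim: w => [|x w IH]; first by rewrite !big_nil.
rewrite !big_cons [flatten _]/=.
have := occ_cat_ge _ v (f x) (tau w); have := occ_cat_le _ v (f x) (tau w); lia.
Qed.

Lemma size_flatten_ge w : (forall x, 0 < size (f x))%N -> (size w <= size (tau w))%N.
Proof.
by move=> f0; elim: w => //= x w IH; rewrite size_cat; have := f0 x; lia.
Qed.

Context (K : nat) (fK : forall x, (size (f x) <= K)%N).

(** Leading letters of [w] are discarded as long as their images fit inside [p]. At the first one
    that does not fit, the rest of [p] is shorter than a single image. *)
Lemma trim_left w p u : tau w = p ++ u ->
  exists w' p', [/\ suffix w' w, tau w' = p' ++ u & (size p' <= K)%N].
Proof.
elim: w p => [|x w IH] p; first by case: p => //= <-; exists [::], [::].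
have [xp|px] := leqP (size (f x)) (size p); last first.
  exists (x :: w), p; split => //; first exact: suffix_refl.
  by apply: leq_trans (fK x); exact: ltnW.
move=> /(congr1 (drop (size (f x)))); rewrite /= drop_size_cat// drop_cat.
case: ltnP => [_|px].
  move=> /IH [w' [p' [sw ew pK]]]; exists w', p'; split => //.
  by case/suffixP: sw => r ->; rewrite -cat_cons suffix_suffix.
have -> : (size (f x) - size p)%N = 0%N by lia.
rewrite drop0 => /(IH [::]) [w' [p' [sw ew pK]]]; exists w', p'; split => //.
by case/suffixP: sw => r ->; rewrite -cat_cons suffix_suffix.
Qed.

Lemma trim_right w u s : tau w = u ++ s ->
  exists w' s', [/\ prefix w' w, tau w' = u ++ s' & (size s' <= K)%N].
Proof.
elim/last_ind: w s => [|w x IH] s.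
  by case: u => //= E; exists [::], [::]; case: s E.
have [xs|sx] := leqP (size (f x)) (size s); last first.
  exists (rcons w x), s; split => //; first exact: prefix_refl.
  by apply: leq_trans (fK x); exact: ltnW.
rewrite map_rcons flatten_rcons => E.
have sE : (size (tau w) + size (f x) = size u + size s)%N by rewrite -!size_cat E.
move: E => /(congr1 (take (size (tau w)))); rewrite take_size_cat// take_cat.
case: ltnP => [|_]; first by lia.
move=> /IH [w' [p' [sw ew pK]]]; exists w', p'; split => //.
by case/prefixP: sw => r ->; rewrite rcons_cat prefix_prefix.
Qed.

(** Trimming both ends yields a preimage whose length is controlled by that of [u], up to a constant
    independent of [u]. *)
Lemma trim_factor w u : infix u (tau w) ->
  exists w' p s, [/\ infix w' w, tau w' = p ++ u ++ s, (size p <= K)%N & (size s <= K)%N].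
Proof.
case/infixP => p [s E]; have [w1 [p' [sw1 E1 pK]]] := trim_left _ _ _ E.
move: E1; rewrite catA => E1; have [w2 [s' [pw2 E2 sK]]] := trim_right _ _ _ E1.
exists w2, p', s'; split => //; last by rewrite catA.
case/suffixP: sw1 => r ->; case/prefixP: pw2 => r' ->.
by apply/infixP; exists r, r'.
Qed.

End factors.

Section directive.
Context (Alph : nat -> alphabetType) (sig : forall n, Alph n.+1 -> seq (Alph n)).

Lemma comp_flatten n k w :
  Defs.comp Alph sig n k w = flatten [seq Defs.comp Alph sig n k [:: a] | a <- w].
Proof.
elim: k w => [w|k IH w] /=; first by elim: w => //= a w {1}->.
rewrite IH; elim: w => [//|a w E] /=.
rewrite /Defs.morph /= map_cat flatten_cat; congr cat; last exact: E.
by rewrite cats0 -IH.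
Qed.

(* The alphabets at levels [j + n + 0] and [j + (n + 0)] are not convertible. *)
Lemma comp_cast p q (e : p = q) (e' : p.+1 = q.+1) (w : seq (Alph p.+1)) :
  ecast m (seq (Alph m)) e (Defs.morph Alph sig p w) =
  Defs.morph Alph sig q (ecast m (seq (Alph m)) e' w).
Proof. by case: q / e e' => e'; rewrite (eq_irrelevance e' erefl). Qed.

Lemma comp_comp n j (e : (j + n + 0)%N = (j + (n + 0))%N) w :
  Defs.comp Alph sig 0 (j + n) w =
  Defs.comp Alph sig 0 n (Defs.comp Alph sig (n + 0) j (ecast m (seq (Alph m)) e w)).
Proof.
elim: j e w => [|j IH] e w; first by rewrite (eq_irrelevance e erefl).
have e' : (j + n + 0)%N = (j + (n + 0))%N by case: e.
by rewrite /= (IH e') (comp_cast _ _ e' e).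
Qed.

Lemma comp_comp_letter n j (a : Alph (j + n + 0)) : exists b : Alph (j + (n + 0)),
  Defs.comp Alph sig 0 (j + n) [:: a] =
  Defs.comp Alph sig 0 n (Defs.comp Alph sig (n + 0) j [:: b]).
Proof.
have e : (j + n + 0)%N = (j + (n + 0))%N by lia.
exists (ecast m (Alph m) e a); rewrite (comp_comp _ _ e).
congr (Defs.comp _ _ _ _ (Defs.comp _ _ _ _ _)).
by case: _ / e.
Qed.
End directive.

(** * Averages of word statistics *)

Lemma drop_window (A : alphabetType) (x : seqsp A) j l i :
  drop i (window A x j l) = window A x (j + i%:Z) (l - i).
Proof.
rewrite /window -map_drop drop_iota add0n -[X in iota X _](addn0 i) iotaDl -map_comp.
by apply/eq_map => k /=; congr (x _); lia.
Qed.

Lemma take_window (A : alphabetType) (x : seqsp A) j l k : (k <= l)%N ->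
  take k (window A x j l) = window A x j k.
Proof. by move=> kl; rewrite /window -map_take take_iota (minn_idPl kl). Qed.

Lemma shift_cylinder (A : alphabetType) j (u : seq A) :
  @Defs.shift A @^-1` cylinder j u = cylinder (j + 1) u.
Proof.
rewrite /cylinder /preimage; apply/funext => x /=; congr (_ = _).
by apply/eq_map => i; rewrite /Defs.shift; congr (x _); lia.
Qed.

Lemma shift_finitary (A : alphabetType) N (S : set (seqsp A)) :
  finitary A N S -> finitary A N.+1 (@Defs.shift A @^-1` S).
Proof. by move=> fS x y Sx xy; apply: fS Sx _ => i iN; apply: xy; lia. Qed.

Lemma shift_measurable (A : alphabetType) :
  measurable_fun setT (@Defs.shift A : borel_seqsp A -> borel_seqsp A).
Proof.
move=> _ Y mY; rewrite setTI.
have : (<<s finitary_sets A >>) Y by move: mY; rewrite borel_finitary.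
pose C := [set Z : set (borel_seqsp A) | measurable (@Defs.shift A @^-1` Z : set (borel_seqsp A))].
suff : <<s finitary_sets A >> `<=` C by apply.
apply: smallest_sub.
  split => [|Z CZ|F CF]; rewrite /C /=.
  - by rewrite preimage_set0; exact: measurable0.
  - by rewrite setTD preimage_setC; exact: measurableC.
  - by rewrite preimage_bigcup; exact: bigcupT_measurable.
by move=> S [N /shift_finitary]; exact: finitary_borel.
Qed.

(** The image of an ultrafilter is an ultrafilter on the compact [[-C, C]]. Thus one [U] serves all
    bounded sequences at once, where a subsequence would depend on the sequence. *)
Lemma ultra_bounded_cvg (R : realType) (U : set_system nat) (a : nat -> R) C :
  UltraFilter U -> (\forall n \near U, `|a n| <= C) -> exists l : R, a @ U --> l.
Proof.
move=> UU aC.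
have FU : ProperFilter U := @ultra_proper _ _ UU.
have aU : UltraFilter (a @ U).
  split => [|G PG UG]; first exact: fmap_proper_filter.
  apply/funext => W; apply/propext; split => [GW|]; last exact: UG.
  have [//|nW] := in_ultra_setVsetC (a @^-1` W) UU.
  have : G (~` W) by apply: UG.
  by move=> /(filterI GW); rewrite setICr => /filter_not_empty.
have : compact [set` `[- C, C]] by exact: segment_compact.
rewrite compact_ultra => /(_ _ aU) [].
  by apply: filterS aC => n /=; rewrite in_itv /= -ler_norml.
by move=> l [_ al]; exists l.
Qed.

Section null_support.
Context (R : realType) (A : alphabetType).
Variable mu : {measure set (borel_seqsp A) -> \bar R}.

(** A point off the support lies in a null cylinder read from some [-N]. There are countably many
    such cylinders, enumerated by [D], so the complement of the support is null. *)
Lemma measure_gt0_support (S : set (borel_seqsp A)) : measurable S ->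
  (0 < mu S)%E -> exists x, S x /\ msupport mu x.
Proof.
move=> mS S0; apply: contrapT => noS.
pose D n : set (borel_seqsp A) :=
  if @unpickle (nat * seq A)%type n is Some (N, u) then
    if mu (cylinder (- N%:Z) u) == 0%E then cylinder (- N%:Z) u else set0
  else set0.
have mD n : measurable (D n).
  rewrite /D; case: unpickle => [[N u]|] //; case: ifP => // _.
  exact: cylinder_borel.
have D0 n : mu (D n) = 0%E.
  rewrite /D; case: unpickle => [[N u]|]; last exact: measure0.
  by case: ifP => [/eqP ->|_] //; exact: measure0.
have SD : S `<=` \bigcup_n D n.
  move=> x Sx; have : ~ msupport mu x by move=> sx; apply: noS; exists x.
  rewrite /msupport /= => /existsNP [V] /not_implyP [oV] /not_implyP [Vx] /negP.
  rewrite -leNgt => V0.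
  have [N NV] := open_ball_cyl A V x oV Vx.
  pose u := window A x (- N%:Z) N.*2.+1.
  have uV : cylinder (- N%:Z) u `<=` V.
    move=> y; rewrite /cylinder /= size_map size_iota => /eq_in_map E.
    apply: NV => i iN.
    have := E (`|(i + N%:Z)%R|%N); rewrite mem_iota.
    have -> : (- N%:Z + `|(i + N%:Z)%R|%N) = i by lia.
    by move=> ->//; lia.
  exists (pickle (N, u)) => //; rewrite /D pickleK.
  have -> : mu (cylinder (- N%:Z) u) = 0%E.
    apply/eqP; rewrite eq_le measure_ge0 andbT; apply: le_trans V0.
    apply: le_measure => //; rewrite inE; first exact: cylinder_borel.
    exact: sub_sigma_algebra.
  by rewrite eqxx; exact: cylinder_window.
have : (mu S <= \sum_(0 <= n <oo) mu (D n))%E.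
  by apply: measure_sigma_subadditive.
rewrite eseries0; last by move=> n _ _; exact: D0.
by rewrite leNgt S0.
Qed.

End null_support.

(** Counts the positions of a word of length [n] from which a word of length [c] would run past the
    end. *)
Lemma sum_overflow (n c : nat) : (\sum_(i < n) (n < i + c)%N <= c)%N.
Proof.
rewrite (reindex_inj rev_ord_inj) /=.
have : (\sum_(i < n) (i.+1 < c)%N <= c)%N.
  suff : (\sum_(i < n) (i.+1 < c)%N <= minn n c)%N by lia.
  elim: n => [|n IH]; first by rewrite big_ord0.
  rewrite big_ord_recr /=.
  have -> : (minn n.+1 c = minn n c + (n < c))%N by case: (ltnP n c); lia.
  by apply: leq_add => //; case: (ltnP n.+1 c); case: (ltnP n c) => //; lia.
move=> H; apply: leq_trans H; apply: leq_sum => i _.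
by have := ltn_ord i; lia.
Qed.

Section weights.
Context (R : realType) (A : alphabetType).
Variable mu : {measure set (borel_seqsp A) -> \bar R}.
Hypothesis mu_fin : (mu setT < +oo)%E.
Hypothesis mu_inv : forall S : set (borel_seqsp A), measurable S ->
  mu (@Defs.shift A @^-1` S) = mu S.

Lemma cylinder_inv j u : mu (cylinder j u) = mu (cylinder 0 u).
Proof.
have H (n : nat) i : mu (cylinder (i + n%:Z) u) = mu (cylinder i u).
  elim: n => [|n IH]; first by rewrite addr0.
  rewrite -IH -(mu_inv (cylinder (i + n%:Z) u)) ?shift_cylinder; last exact: cylinder_borel.
  by congr (mu (cylinder _ _)); lia.
case: (lerP 0 j) => j0.
  by rewrite -(H `|j|%N 0); congr (mu (cylinder _ _)); lia.
by rewrite -(H `|j|%N j); congr (mu (cylinder _ _)); lia.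
Qed.

Lemma measure_fin (S : set (borel_seqsp A)) : measurable S -> mu S \is a fin_num.
Proof.
move=> mS; rewrite ge0_fin_numE//; apply: le_lt_trans mu_fin.
by apply: le_measure; rewrite ?inE.
Qed.

Definition weight (u : seq A) : R := fine (mu (cylinder 0 u)).

Lemma weightE j u : mu (cylinder j u) = (weight u)%:E.
Proof. by rewrite cylinder_inv fineK//; apply: measure_fin; exact: cylinder_borel. Qed.

Lemma weight_ge0 u : 0 <= weight u.
Proof. exact: fine_ge0. Qed.

(** By invariance the cylinder of [v] at position [i] has mass [weight v]. The cylinder of [u] at 0
    lies inside it if [v] is read in [u] at [i], and misses it otherwise. *)
Lemma weight_sum (L i : nat) v : (i + size v <= L)%N ->
  \sum_(u : L.-tuple A) weight u * (prefix v (drop i u))%:R = weight v.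
Proof.
move=> ivL; apply: EFin_inj; rewrite -(weightE i%:Z) -sumEFin.
rewrite (measure_cylinders R A mu 0 L _ (cylinder_borel _ _ _)).
apply: eq_bigr => u _.
have H x : cylinder 0 u x -> cylinder i%:Z v x <-> prefix v (drop i u).
  rewrite /cylinder /= size_tuple prefixE => ux.
  rewrite -[X in drop i X]ux drop_window add0r take_window; last by lia.
  by split => [->|/eqP].
have [pv|pv] := boolP (prefix v (drop i u)).
  rewrite mulr1 -(weightE 0) setIidr// => x ux.
  exact/(H x ux).
rewrite mulr0 (_ : _ `&` _ = set0) ?measure0//.
apply/seteqP; split => // x [vx ux]; move/negP: pv; apply.
exact/(H x ux).
Qed.

(* The normalisation is by the length [L]: [g] is meant to count positions in the word. *)
Definition mean (L : nat) (g : seq A -> R) : R :=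
  L%:R^-1 * \sum_(u : L.-tuple A) weight u * g u.

Lemma mean_le L g h : (forall u, size u = L -> 0 < weight u -> g u <= h u) ->
  mean L g <= mean L h.
Proof.
move=> gh; rewrite ler_wpM2l ?invr_ge0 ?ler0n//; apply: ler_sum => u _.
have [->|w0] := eqVneq (weight u) 0; first by rewrite !mul0r.
by rewrite ler_wpM2l ?weight_ge0// gh ?size_tuple// lt_def w0 weight_ge0.
Qed.

Lemma meanD L g h : mean L (fun u => g u + h u) = mean L g + mean L h.
Proof.
by rewrite /mean -mulrDr -big_split /=; congr (_ * _); apply: eq_bigr => u _; rewrite mulrDr.
Qed.

Lemma mean_sum (I : finType) L (g : I -> seq A -> R) (c : I -> R) :
  mean L (fun u => \sum_b g b u * c b) = \sum_b mean L (g b) * c b.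
Proof.
rewrite /mean.
under [RHS]eq_bigr do rewrite -mulrA mulr_suml.
rewrite -mulr_sumr exchange_big /=; congr (_ * _); apply: eq_bigr => u _.
by rewrite mulr_sumr; apply: eq_bigr => b _; rewrite mulrA.
Qed.

Lemma mean_cst L c : mean L (fun=> c) = weight [::] / L%:R * c.
Proof.
rewrite /mean -mulr_suml mulrA; congr (_ * _); rewrite mulrC; congr (_ / _).
rewrite -(weight_sum L 0 [::]) //; apply: eq_bigr => u _.
by rewrite drop0 prefix0s mulr1.
Qed.

Lemma mean_ge0 L g : (forall u, 0 <= g u) -> 0 <= mean L g.
Proof.
move=> g0; rewrite -[X in X <= _](mulr0 (weight [::] / L%:R)) -(mean_cst L 0).
exact: mean_le.
Qed.

(** Each of the [c] positions where [v] fits into a word of length [L] contributes [weight v], and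
    [L - size v <= c <= L]. *)
Lemma mean_occ L v : (0 < L)%N ->
  weight v - weight v * (size v)%:R / L%:R <= mean L (fun u => (occ A v u)%:R) <= weight v.
Proof.
move=> L0; have L0' : 0 < L%:R :> R by rewrite ltr0n.
pose c := (\sum_(i < L) (i + size v <= L)%N)%N.
have -> : mean L (fun u => (occ A v u)%:R) = weight v * c%:R / L%:R.
  rewrite /mean mulrC; congr (_ / _); rewrite /c natr_sum mulr_sumr.
  under eq_bigr => u _ do rewrite occE natr_sum mulr_sumr size_tuple.
  rewrite exchange_big /=; apply: eq_bigr => i _.
  have [ivL|ivL] := leqP (i + size v)%N L.
    by rewrite mulr1 weight_sum.
  rewrite mulr0 big1 // => u _; rewrite prefixE.
  case: eqP => [/(congr1 size)|]; last by rewrite mulr0.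
  have iL := ltn_ord i; rewrite size_take size_drop size_tuple; move=> E; exfalso.
  move: E ivL iL; move: (size v) (nat_of_ord i) => a b; case: ltnP; lia.
have cL : (c <= L)%N.
  rewrite -[leqRHS](card_ord L) -sum1_card; apply: leq_sum => i _; exact: leq_b1.
have Lc : (L <= c + size v)%N.
  apply: leq_trans (leq_add (leqnn c) (sum_overflow L (size v))).
  rewrite -big_split /= -[leqLHS](card_ord L) -sum1_card; apply: leq_sum => i _.
  by rewrite [(L < _)%N]ltnNge; case: (_ <= L)%N.
have w0 := weight_ge0 v.
apply/andP; split; last first.
  by rewrite ler_pdivrMr// ler_wpM2l// ler_nat.
rewrite lerBlDr -mulrDl -mulrDr ler_pdivlMr// ler_wpM2l//.
by rewrite -natrD ler_nat.
Qed.

End weights.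

(** * Lifting an invariant measure through a morphism *)

Section visits.
Context (B : alphabetType).

(* Coordinate 1, the one read by [cyl], shows the letter of index [i]. Outside of [w] the
   values are arbitrary; only boundedly many positions ever see them. *)
Definition letters_from (w : seq B) (i : nat) : seqsp B :=
  fun k : int => nth point w `|(i%:Z + k - 1)%R|%N.

(** The unnormalised empirical measure of the word [w]. It is defined on every set, so its averages
    and their limits are finitely additive on all sets. *)
Definition visits (S : set (seqsp B)) (w : seq B) : nat :=
  (\sum_(i < size w) `[< S (letters_from w i) >])%N.

Lemma visits_size S w : (visits S w <= size w)%N.
Proof.
rewrite -[leqRHS]card_ord -sum1_card; apply: leq_sum => i _; exact: leq_b1.
Qed.

Lemma visitsU S S' w : S `&` S' = set0 ->
  visits (S `|` S') w = (visits S w + visits S' w)%N.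
Proof.
move=> SS'; rewrite /visits -big_split /=; apply: eq_bigr => i _.
rewrite asbool_or; case: asboolP => Sx; case: asboolP => S'x //.
by have : (S `&` S') (letters_from w i) by []; rewrite SS'.
Qed.

(** The two sums run over the indices [0, ..., size w - 1] and [1, ..., size w], and differ only in
    their end terms. *)
Lemma visits_shift S w :
  (visits (@Defs.shift B @^-1` S) w <= visits S w + 1)%N /\
  (visits S w <= visits (@Defs.shift B @^-1` S) w + 1)%N.
Proof.
pose a i : nat := `[< S (letters_from w i) >].
have -> : visits (@Defs.shift B @^-1` S) w = (\sum_(i < size w) a i.+1)%N.
  apply: eq_bigr => i _; rewrite /a; congr (nat_of_bool `[< S _ >]).
  by apply/funext => k; rewrite /Defs.shift /letters_from; congr (nth _ _ (absz _)); lia.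
have E : (\sum_(i < size w) a i + a (size w) = a 0 + \sum_(i < size w) a i.+1)%N.
  rewrite -(big_mkord xpredT a) -(big_mkord xpredT (fun i => a i.+1)).
  by rewrite -big_nat_recr // big_nat_recl.
have a1 i : (a i <= 1)%N by exact: leq_b1.
have -> : visits S w = (\sum_(i < size w) a i)%N by [].
move: E (a1 0%N) (a1 (size w)).
by move: (\sum_(i < size w) a i)%N (\sum_(i < size w) a i.+1)%N => x y; lia.
Qed.

Lemma visits_cyl b w : visits (cyl b) w = count_mem b w.
Proof.
rewrite -sum1_count (big_nth point) big_mkord big_mkcond; apply: eq_bigr => i _.
rewrite /cyl /letters_from /=; have -> : `|(i%:Z + 1 - 1)%R|%N = i by lia.
by case: asboolP => [->|/eqP/negPf ->]; rewrite ?eqxx.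
Qed.

(** Reading [v] entirely inside [w] would make it a factor, so only the positions where it runs past
    the end remain. *)
Lemma visits_notin v w : ~~ infix v w -> (visits (cylinder 1 v) w <= size v)%N.
Proof.
move=> vw; apply: leq_trans (sum_overflow (size w) (size v)).
apply: leq_sum => i _; case: asboolP => // E.
case: ltnP => // iv; exfalso; move/negP: vw; apply.
have -> : v = take (size v) (drop i w).
  rewrite -[LHS]E; apply: (@eq_from_nth _ point).
    rewrite size_map size_iota size_takel// size_drop.
    by move: iv; move: (size v) (size w) (nat_of_ord i) => x y z; lia.
  move=> k; rewrite size_map size_iota => kv.
  rewrite (nth_map 0%N) ?size_iota// nth_iota// nth_take// nth_drop /letters_from.
  by congr (nth _ _ _); lia.
by apply/infixP; exists (take i w), (drop (size v) (drop i w)); rewrite !cat_take_drop.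
Qed.

End visits.

Section transfer.
Context (R : realType) (A B : alphabetType) (f : B -> seq A).
Hypothesis f_gt0 : forall b, (0 < size (f b))%N.
Local Notation tau w := (flatten (map f w)).
Variable mu : {measure set (borel_seqsp A) -> \bar R}.
Hypothesis mu_fin : (mu setT < +oo)%E.
Hypothesis mu_inv : forall S : set (borel_seqsp A), measurable S ->
  mu (@Defs.shift A @^-1` S) = mu S.
Variables (Lg : seq B -> Prop) (L0 : nat).
Hypothesis Lg_infix : forall v w, Lg w -> infix v w -> Lg v.
Hypothesis Lg_cover : forall u : seq A, (L0 <= size u)%N ->
  (0 < mu (cylinder 0 u))%E -> exists w, Lg w /\ infix u (tau w).

Local Notation weight := (weight R A mu).
Local Notation mean := (mean R A mu).

Lemma transfer_measure :
  exists nu : {measure set (borel_seqsp B) -> \bar R},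
  [/\ (nu setT < +oo)%E,
      (forall S : set (borel_seqsp B), measurable S ->
         nu (@Defs.shift B @^-1` S) = nu S),
      (forall j v, ~ Lg v -> nu (cylinder j v) = 0%E) &
      (forall v, v != [::] ->
        \sum_b fine (nu (cyl b)) * (occ A v (f b))%:R <= weight v <=
        \sum_b fine (nu (cyl b)) * (occ A v (f b) + (size v).-1)%:R)].
Proof.
pose K := (\max_b size (f b))%N.
have fK b : (size (f b) <= K)%N by exact: (leq_bigmax b).
have mu0 (u : seq A) : 0 < weight u -> (0 < mu (cylinder 0 u))%E.
  by rewrite (weightE R A mu mu_fin mu_inv 0) lte_fin.
(* [par u] is the trimmed preimage of [u], with a dummy value when [u] is short or not charged. Its
   length is at most [size u + 2K] because no letter is erased. *)
have /choice [par parP] : forall u, exists w, (L0 <= size u)%N -> 0 < weight u ->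
    [/\ Lg w, (size w <= size u + K.*2)%N &
        exists p s, [/\ tau w = p ++ u ++ s, (size p <= K)%N & (size s <= K)%N]].
  move=> u; have [uL|uL] := leqP L0 (size u); last by exists [::].
  have [u0|u0] := ltP 0 (weight u); last by exists [::].
  have [w [Lw uw]] := Lg_cover u uL (mu0 u u0).
  have [w' [p [s [ww E pK sK]]]] := trim_factor _ _ f K fK w u uw.
  exists w' => _ _; split; first exact: Lg_infix ww.
    apply: leq_trans (size_flatten_ge _ _ f w' f_gt0) _.
    by rewrite E !size_cat addnCA leq_add2l -addnn leq_add.
  by exists p, s.
pose M := weight [::].
have M0 : 0 <= M by exact: weight_ge0.
(* The division is by the length of [u] and not of [par u]: a letter of level [n] stands for a whole
   block, so [nu] has in general a smaller mass than [mu]. *)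
pose m L (S : set (seqsp B)) : R := mean L (fun u => (visits B S (par u))%:R).
have m_ge0 L S : 0 <= m L S by apply: mean_ge0 => // u; exact: ler0n.
have [U [UU UF]] := @ultraFilterLemma nat (\oo) _.
have FU : ProperFilter U := @ultra_proper _ _ UU.
have bigU (n : nat) : \forall L \near U, (n <= L)%N.
  by apply: UF; exact: nbhs_infty_ge.
have m_le L S : (L0 < L)%N -> m L S <= M * (1 + K.*2%:R).
  move=> LL; have L1 : 1 <= L%:R :> R by rewrite ler1n; lia.
  apply: (@le_trans _ _ (mean L (fun=> (L + K.*2)%:R))).
    apply: mean_le => // u uL u0; rewrite ler_nat.
    have [|_ sp _] := parP u _ u0; first by lia.
    by apply: leq_trans (visits_size _ _ _) _; rewrite -uL.
  rewrite mean_cst// -/M -mulrA; apply: ler_wpM2l => //.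
  rewrite ler_pdivrMl ?(lt_le_trans ltr01)// natrD mulrDr mulr1 lerD2l.
  by rewrite ler_peMl// ler0n.
have /choice [lim limP] : forall S, exists l : R, m ^~ S @ U --> l.
  move=> S.
  apply: (@ultra_bounded_cvg _ _ _ (M * (1 + K.*2%:R))) => //.
  by apply: filterS (bigU L0.+1) => L LL; rewrite ger0_norm// m_le.
have lim_le a b (x y : R) : a @ U --> x -> b @ U --> y ->
    (\forall L \near U, a L <= b L) -> x <= y.
  by move=> ax bly ab; apply: ler_cvg_to ab.
have invU : (fun L : nat => L%:R^-1 : R) @ U --> 0.
  have inv_oo : (fun L : nat => L%:R^-1 : R) @ \oo --> 0.
    apply/gtr0_cvgV0; last exact: cvgr_idn.
    by apply: filterS (nbhs_infty_gt 0) => L L1; rewrite ltr0n.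
  by apply: cvg_trans inv_oo; exact: cvg_app.
have inv0 c : (fun L => M / L%:R * c) @ U --> 0.
  rewrite -(mul0r c) -(mulr0 M); apply: cvgM (cvg_cst _).
  exact: cvgM (cvg_cst _) invU.
have lim_ge0 S : 0 <= lim S.
  by apply: (lim_le (fun=> 0) (m ^~ S)) => //; [exact: cvg_cst|exact: nearW].
have limU S S' : S `&` S' = set0 -> lim (S `|` S') = lim S + lim S'.
  move=> SS'; have E L : m L (S `|` S') = m L S + m L S'.
    rewrite /m -meanD; congr (mean L _).
    by apply/funext => u; rewrite visitsU// natrD.
  have lim2 : (fun L => m L S + m L S') @ U --> lim S + lim S' by exact: cvgD.
  apply/eqP; rewrite eq_le; apply/andP; split.
    by apply: lim_le (limP _) lim2 _; apply: nearW => L; rewrite E.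
  by apply: lim_le lim2 (limP _) _; apply: nearW => L; rewrite E.
have [nu nuE] := clopen_content_extend R B lim lim_ge0 limU.
have lim_shift S : lim (@Defs.shift B @^-1` S) = lim S.
  (* A difference of one visit per word contributes at most [M / L] to the average, which vanishes
     in the limit. *)
  have H X Y : (forall w, (visits B X w <= visits B Y w + 1)%N) -> lim X <= lim Y.
    move=> XY; rewrite -[lim Y]addr0.
    apply: (lim_le (m ^~ X) (fun L => m L Y + M / L%:R * 1)) => //.
      by apply: cvgD.
    apply: nearW => L; rewrite -mean_cst// -meanD; apply: mean_le => // u _ _.
    by rewrite -(natrD _ _ 1) ler_nat.
  by apply/eqP; rewrite eq_le !H // => w; have [] := visits_shift B S w.
have nuf : (nu setT < +oo)%E by rewrite nuE ?ltry//; exact: clopenT.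
have nui (S : set (borel_seqsp B)) : measurable S -> nu (@Defs.shift B @^-1` S) = nu S.
  move=> mS.
  pose nu' := @measure_function_pushforward__canonical__measure_function_Measure _ _
     (borel_seqsp B) (borel_seqsp B) R nu (@Defs.shift B) (shift_measurable B).
  have : nu' S = nu S; last by [].
  apply: (borel_measure_ext R B nu' nu) => //.
  move=> N X fX; have sX := shift_finitary _ _ _ fX.
  transitivity (nu (@Defs.shift B @^-1` X)) => //.
  rewrite (nuE _ (finitary_clopen _ _ _ sX)) (nuE _ (finitary_clopen _ _ _ fX)).
  by rewrite lim_shift.
have cyl_clopen j (v : seq B) : clopen (cylinder j v : set (seqsp B)).
  exact: finitary_clopen (cylinder_finitary B j v).
have nub b : fine (nu (cyl b)) = lim (cyl b) by rewrite nuE// cylE.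
have limb b : (fun L => mean L (fun u => (count_mem b (par u))%:R)) @ U --> lim (cyl b).
  have -> : (fun L => mean L (fun u => (count_mem b (par u))%:R)) = m ^~ (cyl b).
    apply/funext => L; congr (mean L _); apply/funext => u.
    by rewrite visits_cyl.
  exact: limP.
have lim_sum (c : B -> R) :
   (fun L => mean L (fun u => \sum_b (count_mem b (par u))%:R * c b)) @ U -->
   \sum_b lim (cyl b) * c b.
  have -> : (fun L => mean L (fun u => \sum_b (count_mem b (par u))%:R * c b)) =
     (fun L => \sum_b mean L (fun u => (count_mem b (par u))%:R) * c b).
    by apply/funext => L; rewrite mean_sum.
  elim: (index_enum B) => [|b r IH].
    rewrite big_nil (_ : (fun _ => _) = fun=> 0); first exact: cvg_cst.
    by apply/funext => L; rewrite big_nil.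
  rewrite big_cons; under eq_fun do rewrite big_cons.
  by apply: cvgD IH; apply: cvgM (limb b) (cvg_cst _).
have lim_occ v : (fun L => mean L (fun u => (occ A v u)%:R)) @ U --> weight v.
  pose lo L := weight v - weight v * (size v)%:R / L%:R.
  apply: (@squeeze_cvgr _ _ _ _ lo (fun=> weight v)); [|  |exact: cvg_cst].
    by apply: filterS (bigU 1%N) => L LL; exact: mean_occ.
  rewrite -[X in _ --> X]subr0 -(mulr0 (weight v * (size v)%:R)).
  by apply: cvgB; [exact: cvg_cst|apply: cvgM invU; exact: cvg_cst].
have sum_count (g : B -> nat) w :
   (\sum_(x <- w) g x)%:R = \sum_b (count_mem b w)%:R * (g b)%:R :> R.
  elim: w => [|x w IH].
    by rewrite big_nil big1// => b _; rewrite mul0r.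
  rewrite big_cons natrD IH /= [in RHS](bigD1 x)//= [in LHS](bigD1 x)//= eqxx.
  rewrite natrD mulrDl mul1r addrA; congr (_ + _); apply: eq_bigr => b bx.
  by rewrite eq_sym (negPf bx).
exists nu; split => //.
(* The cylinder is moved to position 1, where [letters_from] starts reading. As [v] is no factor of
   [par u], it has at most [size v] visits there, which is negligible against [L]. *)
- move=> j v nv; rewrite (weightE R B nu nuf nui) -(weightE R B nu nuf nui 1).
  rewrite nuE//; congr EFin; apply/eqP; rewrite eq_le lim_ge0 andbT.
  apply: (lim_le _ _ _ _ (limP (cylinder 1 v)) (inv0 (size v)%:R)).
  apply: filterS (bigU L0) => L LL.
  rewrite -mean_cst//; apply: mean_le => // u uL u0; rewrite ler_nat.
  apply: visits_notin; apply/negP => vp; apply: nv; apply: Lg_infix vp.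
  by have [] := parP u _ u0; first by rewrite uL.
- move=> v v0; under eq_bigr do rewrite nub.
  under [X in _ <= _ <= X]eq_bigr do rewrite nub.
  apply/andP; split.
  (* The image of [par u] exceeds [u] by at most [2K] letters, so it has at most [2K + 2 * size v]
     more occurrences of [v] than [u], and this excess divided by [L] tends to 0. *)
  + rewrite -[weight v]addr0.
    apply: (lim_le _ (fun L => mean L (fun u => (occ A v u)%:R) +
        M / L%:R * (K.*2 + (size v).*2)%:R) _ _ (lim_sum (fun b => (occ A v (f b))%:R))
      (cvgD (lim_occ v) (inv0 (K.*2 + (size v).*2)%:R))).
    apply: filterS (bigU L0) => L LL; rewrite -mean_cst// -meanD; apply: mean_le => // u uL u0.
    rewrite -sum_count -natrD ler_nat.
    have [|_ _ [p [s [E pK sK]]]] := parP u _ u0.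
      by rewrite uL.
    have /andP[H1 _] := occ_flatten _ _ f v (par u).
    have /andP[_ H2] := occ_infix _ v p u s.
    rewrite E in H1; apply: leq_trans H1 (leq_trans H2 _).
    by rewrite -!addnA leq_add2l addnA leq_add2r -addnn leq_add.
  (* No error term appears here, since [u] is a factor of the image of [par u]. *)
  + apply: (lim_le _ _ _ _ (lim_occ v) (lim_sum (fun b => (occ A v (f b) + (size v).-1)%:R))).
    apply: filterS (bigU L0) => L LL; apply: mean_le => // u uL u0; rewrite -sum_count ler_nat.
    have [|_ _ [p [s [E pK sK]]]] := parP u _ u0.
      by rewrite uL.
    have /andP[_ H1] := occ_flatten _ _ f v (par u).
    have /andP[H2 _] := occ_infix _ v p u s.
    by rewrite E in H1; exact: leq_trans H2 H1.
Qed.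

End transfer.

(** * Letter cones and the conclusion *)

(** Vectors of [C] of rank [d] lift to a family [N] in [D], of rank [d] as well. By maximality [N]
    spans [w] and [w'], and [P] is injective on the row space of [N] because [N *m P] has the same
    rank. *)
Lemma cone_dim_inj (R : realType) (k l d : nat) (C : set 'rV[R]_k) (D : set 'rV[R]_l)
    (P : 'M[R]_(l, k)) :
  cone_dim C d -> cone_dim D d -> (forall v, C v -> exists2 w, D w & v = w *m P) ->
  forall w w', D w -> D w' -> w *m P = w' *m P -> w = w'.
Proof.
move=> [[m [M [MC rM]]] _] [_ Dmax] lift w w' Dw Dw' wP.
have /choice [g gP] : forall i, exists u, D u /\ row i M = u *m P.
  by move=> i; have [u Du ->] := lift _ (MC i); exists u.
pose N := \matrix_i g i.
have NP : N *m P = M.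
  by apply/row_matrixP => i; rewrite row_mul rowK; have [_ ->] := gP i.
pose N' := col_mx N (col_mx w w').
have DN' i : D (row i N').
  rewrite /N'; case: (split_ordP i) => {}i ->.
    by rewrite rowKu rowK; have [] := gP i.
  rewrite rowKd; case: (split_ordP i) => {}i ->.
    by rewrite rowKu (_ : row i w = w)//; apply/rowP => c; rewrite !mxE !ord1.
  by rewrite rowKd (_ : row i w' = w')//; apply/rowP => c; rewrite !mxE !ord1.
have rN' : (\rank N' <= d)%N by exact: Dmax.
have rN : (d <= \rank N)%N by rewrite -rM -NP; exact: mxrankM_maxl.
have sN : (N <= N')%MS by rewrite -(addsmxE N) addsmxSl.
have eqN : (N' <= N)%MS.
  by rewrite -(mxrank_leqif_sup sN) eqn_leq mxrankS//= (leq_trans rN').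
have wN : (w <= N)%MS.
  by apply: submx_trans eqN; rewrite -addsmxE (submx_trans _ (addsmxSr _ _))// -addsmxE addsmxSl.
have wN' : (w' <= N)%MS.
  by apply: submx_trans eqN; rewrite -addsmxE (submx_trans _ (addsmxSr _ _))// -addsmxE addsmxSr.
have ker0 : (N :&: kermx P)%MS = 0.
  apply/eqP; rewrite -mxrank_eq0; have := mxrank_mul_ker N P.
  rewrite NP rM => E; have : (\rank N <= d)%N by exact: leq_trans (mxrankS sN) rN'.
  by lia.
apply/eqP; rewrite -subr_eq0 -submx0 -ker0 sub_capmx; apply/andP; split.
  by rewrite addmx_sub// eqmx_opp.
by apply/sub_kermxP; rewrite mulmxBl wP subrr.
Qed.

(** * Lifting measures along a directive sequence *)

Section levels.
Context (Alph : nat -> alphabetType) (sig : forall n, Alph n.+1 -> seq (Alph n)).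

(** The level-[n] subshift consists of the points whose windows all lie in this set. A word of the
    set need not occur in any such point. *)
Definition factor_language n (w : seq (Alph n)) : Prop :=
  exists k (a : Alph (k + n)), infix w (Defs.comp Alph sig n k [:: a]).

Lemma factor_language_infix n v w :
  factor_language n w -> infix v w -> factor_language n v.
Proof. by move=> [k [a wa]] vw; exists k, a; exact: infix_trans wa. Qed.

(** [L0] exceeds the lengths of all images of letters from levels below [n]. A longer [u] thus comes
    from a level [k >= n], and the image of that letter factors through level [n]. *)
Lemma long_factor n : exists L0, forall u : seq (Alph 0), (L0 <= size u)%N ->
  factor_language 0 u -> exists w : seq (Alph (n + 0)), factor_language (n + 0) w /\
    infix u (flatten [seq Defs.comp Alph sig 0 n [:: b] | b <- w]).
Proof.
pose l k := (\max_(a : Alph (k + 0)) size (Defs.comp Alph sig 0 k [:: a]))%N.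
exists (\max_(k < n) l k).+1 => u uL [k [a ua]].
have nk : (n <= k)%N.
  rewrite leqNgt; apply/negP => kn; move: uL; rewrite ltnNge => /negP; apply.
  apply: leq_trans (size_infix ua) _.
  apply: (@leq_trans (l k)); first exact: (leq_bigmax a).
  exact: (leq_bigmax (Ordinal kn)).
have [j kE] : exists j, k = (j + n)%N by exists (k - n)%N; lia.
subst k; have [b E] := comp_comp_letter Alph sig n j a.
exists (Defs.comp Alph sig (n + 0) j [:: b]); split.
  by exists j, b; exact: infix_refl.
by rewrite -comp_flatten -E.
Qed.

Lemma level_measure (R : realType) (n : nat)
    (mu : {measure set (borel_seqsp (Alph 0)) -> \bar R}) :
  (forall b : Alph (n + 0), (0 < size (Defs.comp Alph sig 0 n [:: b]))%N) ->
  invariant_measure_on (level_subshift Alph sig 0) mu ->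
  exists nu : {measure set (borel_seqsp (Alph (n + 0))) -> \bar R},
    invariant_measure_on (level_subshift Alph sig (n + 0)) nu /\
    forall v, v != [::] ->
      \sum_b fine (nu (cyl b)) * (occ _ v (Defs.comp Alph sig 0 n [:: b]))%:R
        <= weight R _ mu v <=
      \sum_b fine (nu (cyl b)) *
         (occ _ v (Defs.comp Alph sig 0 n [:: b]) + (size v).-1)%:R.
Proof.
move=> f0 [muf mui musupp].
have [L0 L0P] := long_factor n.
have [|nu [nuf nui nu0 nuP]] := transfer_measure R (Alph 0) (Alph (n + 0))
  (fun b => Defs.comp Alph sig 0 n [:: b]) f0 mu muf mui (factor_language (n + 0)) L0
  (factor_language_infix (n + 0)).
  (* A charged cylinder contains a point of the support, hence of the level-0 subshift, which puts
     [u] in the language. *)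
  move=> u uL u0; apply: L0P => //.
  have [x [ux /musupp /(_ 0 (size u)) xX]] :=
    measure_gt0_support R _ mu _ (cylinder_borel _ _ _) u0.
  by rewrite (_ : window _ x 0 (size u) = u) in xX.
(* If a window of a support point were outside the language, its cylinder would be an open null
   neighbourhood of that point. *)
exists nu; split => //; split => // x xs j l; apply: contrapT => nl.
have := xs (cylinder j (window _ x j l)).
rewrite nu0 ?ltxx; last by [].
move=> H; suff: false by []; apply: H; last exact: cylinder_window.
by apply: finitary_open; exact: cylinder_finitary.
Qed.

End levels.

Lemma sum_count_mem (T : finType) (s : seq T) : (\sum_a count_mem a s)%N = size s.
Proof.
elim: s => [|x s IH]; first by rewrite big1.
rewrite /= big_split /= IH (bigD1 x)//= eqxx big1 ?addn0// => a ax.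
by rewrite eq_sym (negPf ax).
Qed.

Section letter_vectors.
Context (R : realType).

Definition letter_vector (A : alphabetType)
    (mu : {measure set (borel_seqsp A) -> \bar R}) : 'rV[R]_#|A| :=
  \row_(i < #|A|) fine (mu (cyl (enum_val i))).

Lemma letter_vectorP (A : alphabetType) (mu nu : {measure set (borel_seqsp A) -> \bar R}) :
  letter_vector A mu = letter_vector A nu -> forall a, fine (mu (cyl a)) = fine (nu (cyl a)).
Proof.
by move=> /rowP E a; have := E (enum_rank a); rewrite !mxE enum_rankK.
Qed.

Definition incidence (A B : alphabetType) (f : B -> seq A) : 'M[R]_(#|B|, #|A|) :=
  \matrix_(i, j) (count_mem (enum_val j) (f (enum_val i)))%:R.

Lemma letter_vector_incidence (A B : alphabetType) (f : B -> seq A)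
    (mu : {measure set (borel_seqsp A) -> \bar R})
    (nu : {measure set (borel_seqsp B) -> \bar R}) :
  (forall a, fine (mu (cyl a)) = \sum_b fine (nu (cyl b)) * (count_mem a (f b))%:R) ->
  letter_vector A mu = letter_vector B nu *m incidence A B f.
Proof.
move=> E; apply/rowP => j; rewrite !mxE E.
rewrite (reindex (@enum_val B B)) /=.
  by apply: eq_bigr => i _; rewrite !mxE.
by apply: onW_bij; exact: enum_val_bij.
Qed.

End letter_vectors.

(** * From letter frequencies to the weights of all words *)

Lemma thin_weight_eq (R : realType) (Alph : nat -> alphabetType)
    (sig : forall n, Alph n.+1 -> seq (Alph n))
    (mu1 mu2 : {measure set (borel_seqsp (Alph 0%N)) -> \bar R}) :
  everywhere_growing Alph sig -> thin_directive Alph sig R ->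
  invariant_measure_on (level_subshift Alph sig 0) mu1 ->
  invariant_measure_on (level_subshift Alph sig 0) mu2 ->
  (forall a, mu1 (cyl a) = mu2 (cyl a)) ->
  forall v, v != [::] -> weight R _ mu1 v = weight R _ mu2 v.
Proof.
move=> grow [d [dim0 dim]] inv1 inv2 E v v0.
have weight_cyl (mu : {measure set (borel_seqsp (Alph 0%N)) -> \bar R}) a :
    invariant_measure_on (level_subshift Alph sig 0) mu ->
    fine (mu (cyl a)) = weight R _ mu [:: a].
  by move=> [mf mi _]; rewrite cylE (weightE R _ mu mf mi).
(* The total mass of [mu1], written through the letters so that it can be compared with its lift. *)
pose T := \sum_a weight R _ mu1 [:: a].
(* As [N] is arbitrary, a nonzero difference would contradict the Archimedean property. *)
suff key N : (0 < N)%N -> `|weight R _ mu1 v - weight R _ mu2 v| * N%:R <= (size v)%:R * T.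
  apply/eqP; rewrite -subr_eq0 -normr_eq0; apply/negPn/negP => neq0.
  set e := `|_| in neq0 key; have e0 : 0 < e by rewrite lt_def neq0 normr_ge0.
  have := key (Num.truncn ((size v)%:R * T / e)).+1 isT.
  rewrite leNgt => /negP; apply; rewrite [e * _]mulrC -ltr_pdivrMr//.
  exact: truncnS_gt.
move=> N0; have [n nP] := grow N.
have {nP} nP := nP n (leqnn n).
pose f b := Defs.comp Alph sig 0 n [:: b].
have f0 b : (0 < size (f b))%N by exact: leq_trans (nP b).
have letters (mu : {measure set (borel_seqsp (Alph 0%N)) -> \bar R})
    (nu : {measure set (borel_seqsp (Alph (n + 0)%N)) -> \bar R}) :
    invariant_measure_on (level_subshift Alph sig 0) mu ->
    (forall v, v != [::] ->
      \sum_b fine (nu (cyl b)) * (occ _ v (f b))%:R <= weight R _ mu v <=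
      \sum_b fine (nu (cyl b)) * (occ _ v (f b) + (size v).-1)%:R) ->
    forall a, fine (mu (cyl a)) = \sum_b fine (nu (cyl b)) * (count_mem a (f b))%:R.
  (* For a single letter [(size v).-1] is 0, so the two bounds coincide. *)
  move=> invmu H a; rewrite (weight_cyl _ _ invmu); have /andP[lo up] := H [:: a] isT.
  apply/le_anti/andP; split.
    by apply: le_trans up _; apply: ler_sum => b _; rewrite occ_seq1 [(count_mem _ _ + _)%N]addn0.
  by apply: le_trans lo; apply: ler_sum => b _; rewrite occ_seq1.
have [nu1 [inu1 b1]] := level_measure Alph sig R n mu1 f0 inv1.
have [nu2 [inu2 b2]] := level_measure Alph sig R n mu2 f0 inv2.
have nuE b : fine (nu1 (cyl b)) = fine (nu2 (cyl b)).
  apply: letter_vectorP; apply: (cone_dim_inj R _ _ d _ _ (incidence R _ _ f) dim0 (dim (n + 0)%N)).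
  - move=> w [mu [imu ->]].
    have [nu [inu bnu]] := level_measure Alph sig R n mu f0 imu.
    exists (letter_vector R _ nu); first by exists nu.
    exact: letter_vector_incidence (letters _ _ imu bnu).
  - by exists nu1.
  - by exists nu2.
  - rewrite -(letter_vector_incidence _ _ _ _ _ _ (letters _ _ inv1 b1)).
    rewrite -(letter_vector_incidence _ _ _ _ _ _ (letters _ _ inv2 b2)).
    by apply/rowP => i; rewrite !mxE E.
pose x b := fine (nu1 (cyl b)).
have x0 b : 0 <= x b by exact: fine_ge0.
(* Summing the letter equalities over [a] gives [T] as the sum of [x b] times the length of [f b],
   and each length is at least [N]. *)
have xT : (\sum_b x b) * N%:R <= T.
  have -> : T = \sum_a \sum_b x b * (count_mem a (f b))%:R.
    apply: eq_bigr => a _.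
    exact: etrans (esym (weight_cyl _ a inv1)) (letters _ _ inv1 b1 a).
  rewrite exchange_big /= mulr_suml; apply: ler_sum => b _.
  rewrite -mulr_sumr -natr_sum sum_count_mem ler_wpM2l// ler_nat; exact: nP.
have split_sum : \sum_b x b * (occ _ v (f b) + (size v).-1)%:R =
    \sum_b x b * (occ _ v (f b))%:R + (\sum_b x b) * (size v).-1%:R.
  by rewrite mulr_suml -big_split; apply: eq_bigr => b _; rewrite natrD mulrDr.
have xsum0 : 0 <= \sum_b x b by apply: sumr_ge0.
(* Since the lifts agree on letters, both weights lie in one interval of length
   [(\sum_b x b) * (size v).-1]. *)
have bound : `|weight R _ mu1 v - weight R _ mu2 v| <= (\sum_b x b) * (size v)%:R.
  have /andP[lo1 up1] := b1 v v0; have /andP[lo2 up2] := b2 v v0.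
  have {}lo2 : \sum_b x b * (occ _ v (f b))%:R <= weight R _ mu2 v.
    by apply: le_trans lo2; apply: ler_sum => b _; rewrite /x nuE.
  have {}up2 : weight R _ mu2 v <= \sum_b x b * (occ _ v (f b) + (size v).-1)%:R.
    by apply: le_trans up2 _; apply: ler_sum => b _; rewrite /x nuE.
  rewrite split_sum in up2.
  rewrite [X in _ <= X]split_sum in up1.
  have : (\sum_b x b) * (size v).-1%:R <= (\sum_b x b) * (size v)%:R.
    by rewrite ler_wpM2l// ler_nat leq_pred.
  rewrite ler_norml; move: lo1 up1 lo2 up2; rewrite -/f.
  move: (\sum_b _) (\sum_b _ * _) => X Y; lra.
apply: (@le_trans _ _ ((\sum_b x b) * (size v)%:R * N%:R)).
  by rewrite ler_wpM2r.
by rewrite mulrAC mulrC ler_wpM2l.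
Qed.

Theorem theorem1 (R : realType) (A : alphabetType) (X : set (seqsp A)) :
  subshift X -> thin_subshift R X ->
  forall mu1 mu2 : {measure set (borel_seqsp A) -> \bar R},
    invariant_measure_on X mu1 -> invariant_measure_on X mu2 ->
    ((forall S : set (borel_seqsp A), measurable S -> mu1 S = mu2 S) <->
     (forall a : A, mu1 (cyl a) = mu2 (cyl a))).
Proof.
move=> _ [Alph' [sig [XE [grow [_ thin]]]]] mu1 mu2; rewrite -XE => inv1 inv2.
split=> [H a|H]; first by apply: H; rewrite cylE; exact: cylinder_borel.
have W := thin_weight_eq R (lvl A Alph') sig mu1 mu2 grow thin inv1 inv2 H.
have {}W v : weight R A mu1 v = weight R A mu2 v.
  (* The weight of the empty word is the total mass, recovered as the sum over one-letter words. *)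
  have [->|] := eqVneq v [::]; last exact: W.
  have [f1 i1 _] := inv1; have [f2 i2 _] := inv2.
  rewrite -(weight_sum R A mu1 f1 i1 1 0 [::]) // -(weight_sum R A mu2 f2 i2 1 0 [::]) //.
  apply: eq_bigr => u _; congr (_ * _); apply: W.
  by rewrite -size_eq0 size_tuple.
have [f1 i1 _] := inv1; have [f2 i2 _] := inv2.
apply: (borel_measure_ext R A mu1 mu2 f1); apply: finitary_measure_eq => j u.
by rewrite (weightE R A mu1 f1 i1) (weightE R A mu2 f2 i2) W.
Qed.
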